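(* Let $G=(V,E,\omega)\in\mathcal{G}$, and for $\varepsilon>0$ let $f_\varepsilon^+:\mathcal{V}\to\mathbb{R}$ be the signless Ginzburg-Landau functional $$f_\varepsilon^+(u):=\frac12\sum_{i,j\in V}\omega_{ij}(u_i+u_j)^2+\frac1\varepsilon\sum_{i\in V}W(u_i),$$ and let $f_0^+:\mathcal{V}\to\mathbb{R}\cup\{+\infty\}$ be defined by $$f_0^+(u):=\begin{cases}\sum_{i,j\in V}\omega_{ij}|u_i+u_j|,&\text{if }u\in\mathcal{V}^b,\\ +\infty,&\text{if }u\in\mathcal{V}\setminus\mathcal{V}^b.\end{cases}$$ Then $f_\varepsilon^+$ $\Gamma$-converges to $f_0^+$ as $\varepsilon\downarrow0$ in the following sense: if $\{\varepsilon_k\}_{k\in\mathbb{N}}$ is a sequence of positive real numbers such that $\varepsilon_k\downarrow0$ as $k\to\infty$ and $u_0\in\mathcal{V}$, then the following two conditions are satisfied: (LB) for every sequence $\{u_k\}_{k=1}^\infty\subset\mathcal{V}$ such that $u_k\to u_0$ as $k\to\infty$, it holds that $f_0^+(u_0)\leq\liminf_{k\to\infty}f_{\varepsilon_k}^+(u_k)$; (UB) there exists a sequence $\{u_k\}_{k=1}^\infty\subset\mathcal{V}$ such that $u_k\to u_0$ as $k\to\infty$ and $f_0^+(u_0)\geq\limsup_{k\to\infty}f_{\varepsilon_k}^+(u_k)$.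
   Context: $\mathcal{G}$ denotes the set of non-empty finite, simple (no self-loops, no multiple edges), undirected, edge-weighted graphs $G=(V,E,\omega)$ without isolated nodes, with $V=\{1,\dots,n\}$. The edge weights satisfy $\omega_{ij}=\omega_{ji}>0$ if $(i,j)\in E$, and $\omega$ is extended to $V^2$ by $\omega_{ij}=0$ if $(i,j)\notin E$ (in particular $\omega_{ii}=0$). The degree of node $i$ is $d_i:=\sum_{j\in V}\omega_{ij}$, so $d_i>0$. $\mathcal{V}$ is the set of all functions $u:V\to\mathbb{R}$ (write $u_i:=u(i)$), identified with $\mathbb{R}^n$. $\mathcal{V}^b:=\{u\in\mathcal{V}:\forall i\in V,\ u_i\in\{-1,1\}\}$. $W(x):=(x^2-1)^2$ for $x\in\mathbb{R}$. Convergence in $\mathcal{V}$ is with respect to the norm $\|u\|_{\mathcal{V}}:=\left(\sum_{i\in V}u_i^2d_i^r\right)^{1/2}$ with $r\in[0,1]$ fixed (all norms on $\mathcal{V}\cong\mathbb{R}^n$ are equivalent). *)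

(* Defs.v *)
From HB Require Import structures.
From mathcomp Require Import all_boot all_order all_algebra.
From mathcomp Require Import all_classical all_reals all_analysis.
Set Implicit Arguments.
Unset Strict Implicit.
Unset Printing Implicit Defensive.
Import Order.TTheory GRing.Theory Num.Theory.
Import numFieldNormedType.Exports.
Local Open Scope classical_set_scope.
Local Open Scope ring_scope.

(* Nodes are numbered 0, ..., n-1; [weight] is the extension of the edge
   weights by zero to all pairs of nodes. *)
Record wgraph (R : realType) := WGraph {
  num_nodes : nat ;
  edge : rel 'I_num_nodes ;
  weight : 'I_num_nodes -> 'I_num_nodes -> R ;
  num_nodes_gt0 : (0 < num_nodes)%N ;
  edge_sym : symmetric edge ;
  edge_irr : irreflexive edge ;
  weight_sym : forall i j, weight i j = weight j i ;
  weight_gt0 : forall i j, edge i j -> 0 < weight i j ;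
  weight_eq0 : forall i j, ~~ edge i j -> weight i j = 0 ;
  no_isolated : forall i, exists j, edge i j
}.

Definition node (R : realType) (G : wgraph R) := 'I_(num_nodes G).

Definition nodefun (R : realType) (G : wgraph R) := node G -> R.

Definition node_degree (R : realType) (G : wgraph R) (i : node G) : R :=
  \sum_(j : node G) weight i j.

Definition norm_nodefun (R : realType) (G : wgraph R) (r : R) (u : nodefun G) : R :=
  Num.sqrt (\sum_(i : node G) u i ^+ 2 * node_degree i `^ r).

Definition cvg_nodefun (R : realType) (G : wgraph R) (r : R)
    (u : nat -> nodefun G) (u0 : nodefun G) : Prop :=
  norm_nodefun r (fun i => u k i - u0 i) @[k --> \oo] --> 0.

Definition binary_nodefun (R : realType) (G : wgraph R) : set (nodefun G) :=
  [set u | forall i, u i = -1 \/ u i = 1].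

Definition double_well (R : realType) (x : R) : R := (x ^+ 2 - 1) ^+ 2.

Definition signless_GL (R : realType) (G : wgraph R) (eps : R)
    (u : nodefun G) : R :=
  2^-1 * (\sum_(i : node G) \sum_(j : node G)
            weight i j * (u i + u j) ^+ 2)
  + eps^-1 * \sum_(i : node G) double_well (u i).

Definition signless_GL0 (R : realType) (G : wgraph R)
    (u : nodefun G) : \bar R :=
  if u \in @binary_nodefun R G then
    (\sum_(i : node G) \sum_(j : node G) weight i j * `|u i + u j|)%:E
  else +oo%E.

(* Main.v *)
Require Import Defs.
From HB Require Import structures.
From mathcomp Require Import all_boot all_order all_algebra.
From mathcomp Require Import all_classical all_reals all_analysis.
Import Order.TTheory GRing.Theory Num.Theory.
Import numFieldNormedType.Exports.
Local Open Scope classical_set_scope.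
Local Open Scope ring_scope.

(** The functional splits as the quadratic form
      Q(u) = 1/2 sum_ij w_ij (u_i + u_j)^2
    plus the penalty 1/eps sum_i W(u_i), both nonnegative.

    On binary functions the penalty vanishes, and u_i + u_j only takes the
    values -2, 0, 2, on which x^2 / 2 = |x|; hence every f_eps agrees there with
    the limit functional ([signless_GL_binary]). The constant sequence u_k = u0
    is therefore a recovery sequence: it attains the limit value when u0 is
    binary, and there is nothing to prove when the limit value is +oo.

    For the lower bound, convergence in the weighted norm gives convergence at
    every node, because degrees are positive ([cvg_nodefun_pointwise]). It then
    suffices to minorize f_eps_k(u_k) by a sequence whose limit is the limit
    functional at u0 ([limn_einf_ge_cvg]). If u0 is binary, Q(u_k) is such a
    minorant, as Q is continuous. If u0 is not binary, then W(u0 i) > 0 at some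
    node i, and the single penalty term W(u_k i) / eps_k already tends to
    +oo. *)

Lemma cvg_finsum {R : realType} {I : finType} {f : nat -> I -> R} {g : I -> R} :
  (forall i, f k i @[k --> \oo] --> g i) ->
  \sum_i f k i @[k --> \oo] --> \sum_i g i.
Proof.
move=> fg.
by apply: (@cvg_big R I +%R 0 xpredT add_continuous _ _ _ (fun i k => f k i)).
Qed.

Lemma limn_einf_ge_cvg {R : realType} {v w : nat -> \bar R} {l : \bar R} :
  v k @[k --> \oo] --> l -> (forall k, v k <= w k)%E ->
  (l <= limn_einf w)%E.
Proof.
move=> vl vw; rewrite -(cvg_limn_einf_sup vl).1 !limn_einf_lim.
apply: lee_lim; [exact: is_cvg_einfs|exact: is_cvg_einfs|].
apply: nearW => n; apply: le_ereal_inf_tmp => _ [k nk <-].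
by apply: le_trans (vw k); apply: ereal_inf_lbound; exists k.
Qed.

Section Graph.
Context {R : realType} {G : wgraph R}.
Implicit Types (i j : node G) (u : nodefun G).

Lemma weight_ge0 i j : 0 <= weight i j.
Proof.
have [/weight_gt0/ltW//|/weight_eq0->//] := boolP (edge i j).
Qed.

Lemma node_degree_gt0 i : 0 < node_degree i.
Proof.
have [j ij] := no_isolated i.
rewrite /node_degree (bigD1 j)//= ltr_wpDr ?weight_gt0//.
by apply: sumr_ge0 => k _; exact: weight_ge0.
Qed.

Lemma double_well_ge0 (x : R) : 0 <= double_well x.
Proof. exact: sqr_ge0. Qed.

Lemma double_well_eq0 (x : R) : double_well x = 0 <-> x = -1 \/ x = 1.
Proof.
rewrite /double_well; split=> [/eqP|[]->]; last 2 first.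
- by rewrite sqrrN expr1n subrr expr0n.
- by rewrite expr1n subrr expr0n.
rewrite sqrf_eq0 subr_eq0 sqrf_eq1 => /orP[]/eqP; by [right|left].
Qed.

Lemma continuous_double_well : continuous (@double_well R).
Proof.
move=> x; apply: (@continuous_comp _ _ _ (fun y : R => y ^+ 2 - 1)
                                         (fun y : R => y ^+ 2)).
  apply: cvgB; [exact: exprn_continuous|exact: cvg_cst].
exact: exprn_continuous.
Qed.

Definition signless_form u : R :=
  2^-1 * \sum_(i : node G) \sum_(j : node G) weight i j * (u i + u j) ^+ 2.

Lemma signless_form_ge0 u : 0 <= signless_form u.
Proof.
rewrite mulr_ge0 ?invr_ge0//; apply: sumr_ge0 => i _; apply: sumr_ge0 => j _.
by rewrite mulr_ge0 ?weight_ge0 ?sqr_ge0.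
Qed.

Lemma signless_form_le (eps : R) u : 0 < eps ->
  signless_form u <= signless_GL eps u.
Proof.
move=> e0; rewrite lerDl mulr_ge0 ?invr_ge0 ?(ltW e0)//.
by apply: sumr_ge0 => i _; exact: double_well_ge0.
Qed.

Lemma penalty_le (eps : R) u i : 0 < eps ->
  eps^-1 * double_well (u i) <= signless_GL eps u.
Proof.
move=> e0; apply: ler_wpDl; first exact: signless_form_ge0.
rewrite ler_wpM2l ?invr_ge0 ?(ltW e0)// (bigD1 i)//= lerDl.
by apply: sumr_ge0 => j _; exact: double_well_ge0.
Qed.

(** Sums of two values in {-1, 1} lie in {-2, 0, 2}, exactly the solutions of
    x^2 / 2 = |x|. *)
Lemma signless_form_binary u : binary_nodefun u ->
  signless_form u = \sum_(i : node G) \sum_(j : node G) weight i j * `|u i + u j|.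
Proof.
move=> bu; rewrite /signless_form mulr_sumr; apply: eq_bigr => i _.
rewrite mulr_sumr; apply: eq_bigr => j _; rewrite mulrCA; congr (_ * _).
have half2 : 2^-1 * (1 + 1) ^+ 2 = 1 + 1 :> R.
  by rewrite expr2 mulKf// pnatr_eq0.
case: (bu i) (bu j) => -> [] ->.
- by rewrite -opprD sqrrN normrN half2 ger0_norm.
- by rewrite addNr normr0 expr0n mulr0.
- by rewrite subrr normr0 expr0n mulr0.
- by rewrite half2 ger0_norm.
Qed.

Lemma signless_GL_binary (eps : R) u : binary_nodefun u ->
  (signless_GL eps u)%:E = signless_GL0 u.
Proof.
move=> bu; rewrite /signless_GL0 mem_set// -signless_form_binary//.
congr EFin; rewrite /signless_GL [X in _ + X](_ : _ = 0) ?addr0//.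
rewrite big1 ?mulr0// => i _.
exact/double_well_eq0.
Qed.

(** Each coordinate is controlled by the norm, with constant the square root
    of the positive number d_i^r. *)
Lemma cvg_nodefun_pointwise {r : R} {u : nat -> nodefun G} {u0 : nodefun G} i :
  cvg_nodefun r u u0 -> u k i @[k --> \oo] --> u0 i.
Proof.
move=> uu0; pose c : R := Num.sqrt (node_degree i `^ r).
have c0 : 0 < c by rewrite sqrtr_gt0 powR_gt0// node_degree_gt0.
apply/cvgrPdist_lt => e e0.
have /cvgr0Pnorm_lt/(_ (c * e)) := uu0; rewrite mulr_gt0// => /(_ isT).
apply: filterS => k; rewrite ger0_norm ?sqrtr_ge0// distrC => uke.
rewrite -(ltr_pM2l c0); apply: le_lt_trans uke.
rewrite -sqrtr_sqr -sqrtrM ?powR_ge0// ler_wsqrtr// mulrC (bigD1 i)//= lerDl.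
by apply: sumr_ge0 => j _; rewrite mulr_ge0 ?sqr_ge0 ?powR_ge0.
Qed.

Lemma cvg_signless_form {u : nat -> nodefun G} {u0 : nodefun G} :
  (forall i, u k i @[k --> \oo] --> u0 i) ->
  signless_form (u k) @[k --> \oo] --> signless_form u0.
Proof.
move=> uu0; apply: cvgMl_tmp.
apply: cvg_finsum => i; apply: cvg_finsum => j.
apply: cvgMl_tmp.
have uij : u k i + u k j @[k --> \oo] --> u0 i + u0 j.
  by apply: cvgD; exact: uu0.
exact: (cvgM uij uij).
Qed.

(** Off the binary functions, the well term of a single bad node, scaled by
    1/eps, forces divergence: W(u_k i) stays away from 0 by continuity. *)
Lemma cvg_penalty_pinfty {eps : nat -> R} {u : nat -> nodefun G}
    {u0 : nodefun G} {i : node G} :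
  (forall k, 0 < eps k) -> eps k @[k --> \oo] --> 0^'+ ->
  u k i @[k --> \oo] --> u0 i -> double_well (u0 i) <> 0 ->
  ((eps k)^-1 * double_well (u k i))%:E @[k --> \oo] --> +oo%E.
Proof.
move=> e0 ecvg uu0 /eqP Wi.
have W0 : 0 < double_well (u0 i) by rewrite lt0r Wi double_well_ge0.
have einv : ((eps k)^-1)%:E @[k --> \oo] --> +oo%E.
  apply/cvgeryP/cvgrVy; first exact: nearW.
  apply: (cvg_trans ecvg); exact: cvg_within.
have Wcvg : (double_well (u k i))%:E @[k --> \oo] --> (double_well (u0 i))%:E.
  apply: cvg_EFin; first exact: nearW.
  by apply: (continuous_cvg _ _ uu0); exact: continuous_double_well.
rewrite -(@gt0_mulye _ (double_well (u0 i))%:E) ?lte_fin//.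
by apply: (cvgeM _ einv Wcvg); rewrite mule_def_infty_neq0// gt_eqF.
Qed.

End Graph.

Theorem lemma4p3 (R : realType) (G : wgraph R) (r : R)
    (hr0 : 0 <= r) (hr1 : r <= 1)
    (eps : nat -> R) (eps_gt0 : forall k, 0 < eps k)
    (eps_cvg : eps k @[k --> \oo] --> 0^'+)
    (u0 : nodefun G) :
  (forall u : nat -> nodefun G, cvg_nodefun r u u0 ->
     (signless_GL0 u0 <=
        limn_einf (fun k => (signless_GL (eps k) (u k))%:E))%E)
  /\
  (exists2 u : nat -> nodefun G, cvg_nodefun r u u0 &
     (limn_esup (fun k => (signless_GL (eps k) (u k))%:E) <=
        signless_GL0 u0)%E).
Proof.
split=> [u uu0|].
- have ptw i := cvg_nodefun_pointwise i uu0.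
  have [bu|nbu] := pselect (binary_nodefun u0).
    rewrite /signless_GL0 mem_set// -signless_form_binary//.
    apply: (@limn_einf_ge_cvg _ (fun k => (signless_form (u k))%:E)) => [|k].
      apply: cvg_EFin; first exact: nearW.
      exact: cvg_signless_form.
    by rewrite lee_fin signless_form_le.
  have /existsNP[i /double_well_eq0 Wi] := nbu.
  rewrite /signless_GL0 memNset//.
  apply: (limn_einf_ge_cvg (cvg_penalty_pinfty eps_gt0 eps_cvg (ptw i) Wi)) => k.
  by rewrite lee_fin penalty_le.
- exists (fun=> u0).
    rewrite /cvg_nodefun (_ : norm_nodefun r _ = 0); first exact: cvg_cst.
    rewrite /norm_nodefun big1 ?sqrtr0// => i _.
    by rewrite subrr expr0n mul0r.
  have [bu|nbu] := pselect (binary_nodefun u0); last first.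
    by rewrite /signless_GL0 memNset ?leey.
  under eq_fun do rewrite signless_GL_binary//.
  by rewrite (cvg_limn_einf_sup (cvg_cst _)).2.
Qed.
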